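(* There exist a bounded domain $\Omega\subset\mathbb{R}^2$, a point $x\in\Omega$ and a boundary point $\xi\in\partial\Omega$ such that: (i) $\xi\in\partial_x^{\mathrm{dir}}\Omega$; (ii) $\xi\notin\partial^{\mathrm{str}}_{x,\alpha}\Omega$ for every $\alpha\in(0,1]$; (iii) $\xi\in v_x(4)\text{-}\partial\Omega$.
   Context: A domain is a nonempty connected open set. $d_\Omega(y):=\operatorname{dist}(y,\partial\Omega)$. For $x\ne\xi$, $[x,\xi):=\{(1-t)x+t\xi:0\le t<1\}$. The directly visible boundary is $\partial_x^{\mathrm{dir}}\Omega:=\{\xi\in\partial\Omega:[x,\xi)\subset\Omega\}$. For $\alpha\in(0,1]$ the quantitatively straight visible boundary is $$\partial^{\mathrm{str}}_{x,\alpha}\Omega:=\bigl\{\xi\in\partial_x^{\mathrm{dir}}\Omega:\ d_\Omega((1-t)x+t\xi)\ge\alpha\min\{t,1-t\}|x-\xi|\ \text{ for every }t\in(0,1)\bigr\}.$$ For $c\ge1$, the visual boundary $v_x(c)\text{-}\partial\Omega$ is the set of $\xi\in\partial\Omega$ that can be joined to $x$ by a rectifiable curve $\gamma:[0,\ell]\to\Omega\cup\{\xi\}$, parametrised by arc length, with $\gamma(0)=x$, $\gamma(\ell)=\xi$, $\ell\le c|x-\xi|$ and $d_\Omega(\gamma(t))\ge c^{-1}\min\{t,\ell-t\}$ for $0<t<\ell$. *)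

(* Defs.v *)
From mathcomp Require Import all_boot all_order all_algebra.
From mathcomp Require Import all_classical all_reals all_analysis.
Import Order.TTheory GRing.Theory Num.Theory.
Import numFieldNormedType.Exports.

Set Implicit Arguments.
Unset Strict Implicit.
Unset Printing Implicit Defensive.

Local Open Scope classical_set_scope.
Local Open Scope ring_scope.

Section Domains.
Context {R : realType} {n : nat}.
Implicit Types (Omega A : set 'rV[R]_n) (x y xi : 'rV[R]_n).
Implicit Types (gamma : R -> 'rV[R]_n).

(* The library norm `|x| on 'rV[R]_n is the sup norm; it induces the usual
   topology and the usual bounded sets, so the library's open, closure,
   connected, continuous and bounded_set are kept. All metric quantities
   (distances, lengths) use the Euclidean norm below. *)
Definition enorm x : R := Num.sqrt (\sum_(i < n) x ord0 i ^+ 2).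

Definition domain Omega := [/\ Omega !=set0, open Omega & connected Omega].

Definition boundary A : set 'rV[R]_n := closure A `\` interior A.

(* inf set0 = 0, so this is only meaningful for A !=set0. *)
Definition dist y A : R := inf [set enorm (y - z) | z in A].

Definition bdist Omega y : R := dist y (boundary Omega).

Definition seg x xi (t : R) : 'rV[R]_n := (1 - t) *: x + t *: xi.

Definition dir_boundary Omega x : set 'rV[R]_n :=
  [set xi | boundary Omega xi /\ seg x xi @` `[0, 1[ `<=` Omega].

Definition str_boundary Omega x (alpha : R) : set 'rV[R]_n :=
  [set xi | dir_boundary Omega x xi /\
    forall t : R, 0 < t < 1 ->
      alpha * Num.min t (1 - t) * enorm (x - xi) <= bdist Omega (seg x xi t)].

(* Length of the polygon inscribed in gamma with nodes a :: s, the analogue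
   for vector-valued maps of the library's real-valued variation a b f s. *)
Definition polygon_length gamma (a b : R) (s : seq R) : R :=
  let F := gamma \o nth b (a :: s) in
  \sum_(0 <= k < size s) enorm (F k.+1 - F k).

Definition curve_length gamma (a b : R) : \bar R :=
  ereal_sup [set (polygon_length gamma a b s)%:E | s in itv_partition a b].

Definition rectifiable gamma (a b : R) := (curve_length gamma a b < +oo)%E.

(* Only the values of gamma on [0, l] matter. *)
Definition arclength_curve gamma (l : R) :=
  [/\ {within `[0, l], continuous gamma}, rectifiable gamma 0 l &
      forall s t : R, 0 <= s -> s <= t -> t <= l ->
        curve_length gamma s t = (t - s)%:E].

Definition visual_boundary Omega x (c : R) : set 'rV[R]_n :=
  [set xi | boundary Omega xi /\
    exists (l : R) (gamma : R -> 'rV[R]_n),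
      [/\ 0 <= l /\ arclength_curve gamma l,
          gamma @` `[0, l] `<=` Omega `|` [set xi],
          gamma 0 = x /\ gamma l = xi,
          l <= c * enorm (x - xi) &
          forall t : R, 0 < t < l ->
            c^-1 * Num.min t (l - t) <= bdist Omega (gamma t)]].

End Domains.

(* Main.v *)
Require Import Defs.
From mathcomp Require Import all_boot all_order all_algebra.
From mathcomp Require Import all_classical all_reals all_analysis.
From mathcomp Require Import ring lra.
Import Order.TTheory GRing.Theory Num.Theory.
Import numFieldNormedType.Exports.
Local Open Scope classical_set_scope.
Local Open Scope ring_scope.

(** The domain is the part of the open square of half-side 8 lying above the
    parabola y = - x^2 / 16, and xi is the origin, where the horizontal axis
    is tangent to that parabola.  From x = (6, 0) the segment to xi stays in
    the domain, but at horizontal distance u from xi it is within u^2 / 16 of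
    the parabola, so no linear lower bound on the distance to the boundary
    survives near xi: xi is not straight visible, for any alpha
    ([Omega_not_str]).

    The open upper half of the square lies in the domain, so a curve that climbs
    away from the axis and comes down to xi along a transversal direction keeps
    a distance to the boundary comparable to its height.  The curve used is the
    tent with apex (3, 4): its two sides are hypotenuses of 3-4-5 triangles, so
    it is parametrised by arc length on [0, 10] with rational coefficients, has
    length 10 <= 4 * 6, and has height 4/5 min(t, 10 - t), which leaves ample
    room for the factor 1/4 ([tent_ball]).  That it is an arc-length
    parametrisation is an instance of [arclength_curve_kinked]: a 1-Lipschitz
    curve that is isometric before and after a single parameter has length
    t - s on each [s, t].

    The domain is connected because it is star-shaped about (0, 4); shrinking
    towards that point also moves points of the parabola into the domain, which
    identifies them as boundary points ([Omega_seg], [boundary_parabola]). *)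

(** * Euclidean norm and distance to the boundary *)

Section EuclideanNorm.
Context {R : realType} {n : nat}.
Implicit Types (A Omega : set 'rV[R]_n) (y z : 'rV[R]_n) (gamma : R -> 'rV[R]_n).

Lemma enorm_ge0 y : 0 <= enorm y.
Proof. exact: sqrtr_ge0. Qed.

Lemma enorm0 : enorm (0 : 'rV[R]_n) = 0.
Proof.
by rewrite /enorm big1 ?sqrtr0// => i _; rewrite mxE expr0n.
Qed.

Lemma coord_le_enorm y i : `|y ord0 i| <= enorm y.
Proof.
rewrite -sqrtr_sqr; apply: ler_wsqrtr.
rewrite (bigD1 i)//= lerDl; apply: sumr_ge0 => j _; exact: sqr_ge0.
Qed.

Lemma dist_le y z A : A z -> dist y A <= enorm (y - z).
Proof.
move=> Az; apply: ge_inf; last by exists z.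
by exists 0 => _ [w _ <-]; exact: enorm_ge0.
Qed.

(** Since an open set contains no point of its boundary, an inscribed Euclidean
    ball bounds the distance to the boundary from below.  The boundary has to
    be nonempty because the distance to the empty set is 0. *)
Lemma bdist_ge Omega y r : open Omega -> boundary Omega !=set0 ->
  (forall z, enorm (y - z) < r -> Omega z) -> r <= bdist Omega y.
Proof.
move=> oO [b bb] yr; apply: lb_le_inf; first by exists (enorm (y - b)), b.
move=> _ [z [_ iz] <-]; rewrite leNgt; apply/negP => /yr Oz.
by apply: iz; rewrite (interior_id Omega).1.
Qed.

(** * Arc-length parametrisations *)

Definition lipschitz1 gamma :=
  forall s t, s <= t -> enorm (gamma t - gamma s) <= t - s.

Lemma lipschitz1_continuous gamma : lipschitz1 gamma -> continuous gamma.
Proof.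
move=> lip t B /= /(nbhs_ballP (gamma t)) [e e0 eB].
apply/nbhs_ballP; exists e => //= s /= ts.
apply: eB; split => // i j; rewrite (ord1 i) /ball/=.
have [st|/ltW st] := leP s t.
  have := le_trans (coord_le_enorm (gamma t - gamma s) j) (lip _ _ st).
  rewrite !mxE => /le_lt_trans; apply.
  by apply: le_lt_trans ts; exact: ler_norm.
rewrite distrC.
have := le_trans (coord_le_enorm (gamma s - gamma t) j) (lip _ _ st).
rewrite !mxE => /le_lt_trans; apply.
by apply: le_lt_trans ts; rewrite distrC; exact: ler_norm.
Qed.

(** The increments of the parameter along a partition telescope. *)
Lemma polygon_length_le gamma a b s : lipschitz1 gamma ->
  itv_partition a b s -> polygon_length gamma a b s <= b - a.
Proof.
move=> lip [/(pathP b) ps /eqP lab].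
have -> : b - a = \sum_(0 <= k < size s)
    (nth b (a :: s) k.+1 - nth b (a :: s) k).
  by rewrite telescope_sumr// -last_nth lab.
rewrite /polygon_length !big_mkord; apply: ler_sum => i _ /=.
exact/lip/ltW/(ps i).
Qed.

Lemma curve_length_le gamma a b : lipschitz1 gamma ->
  (curve_length gamma a b <= (b - a)%:E)%E.
Proof.
move=> lip; apply: ge_ereal_sup => _ [s ps <-].
by rewrite lee_fin; exact: polygon_length_le.
Qed.

Lemma chord_le_curve_length gamma a b : a < b ->
  ((enorm (gamma b - gamma a))%:E <= curve_length gamma a b)%E.
Proof.
move=> ab; apply: ereal_sup_ubound; exists [:: b].
  by split => //=; rewrite ab.
by rewrite /polygon_length big_nat1.
Qed.

Lemma two_chords_le_curve_length gamma a c b : a < c -> c < b ->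
  ((enorm (gamma c - gamma a) + enorm (gamma b - gamma c))%:E
    <= curve_length gamma a b)%E.
Proof.
move=> ac cb; apply: ereal_sup_ubound; exists [:: c; b].
  by split => //=; rewrite ac cb.
by rewrite /polygon_length big_nat_recr//= big_nat1.
Qed.

Lemma curve_length_point gamma a : curve_length gamma a a = 0%E.
Proof.
rewrite /curve_length (_ : [set _ | _ in _] = [set 0%E]) ?ereal_sup1//.
apply/seteqP; split => [_ [s [ps /eqP la] <-]|_ ->].
  case: s ps la => [|c s] ps la.
    by rewrite /polygon_length big_geq.
  have /(order_path_min lt_trans)/allP/(_ (last c s)) := ps.
  rewrite mem_last => /(_ isT).
  by rewrite -[X in _ < X]/(last a (c :: s)) la ltxx.
by exists [::]; rewrite ?/polygon_length ?big_geq.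
Qed.

(** Before and after [c] a single chord already realises the length; across [c]
    the inscribed polygon with the extra node [c] does. *)
Lemma arclength_curve_kinked gamma c l : 0 <= l -> lipschitz1 gamma ->
  (forall s t, s <= t -> t <= c -> enorm (gamma t - gamma s) = t - s) ->
  (forall s t, c <= s -> s <= t -> enorm (gamma t - gamma s) = t - s) ->
  arclength_curve gamma l.
Proof.
move=> l0 lip isoL isoR.
have len s t : s <= t -> curve_length gamma s t = (t - s)%:E.
  rewrite le_eqVlt => /predU1P[->|st]; first by rewrite curve_length_point subrr.
  apply/eqP; rewrite eq_le curve_length_le//=.
  have [tc|ct] := leP t c.
    by rewrite -(isoL _ _ (ltW st) tc); exact: chord_le_curve_length.
  have [cs|sc] := leP c s.
    by rewrite -(isoR _ _ cs (ltW st)); exact: chord_le_curve_length.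
  apply: le_trans (two_chords_le_curve_length gamma _ _ _ sc ct).
  rewrite isoL ?(ltW sc)// isoR ?(ltW ct)// lee_fin; lra.
split; first exact/continuous_subspaceT/lipschitz1_continuous.
  by rewrite /rectifiable len// ltry.
by move=> s t _ st _; exact: len.
Qed.

End EuclideanNorm.

(** * The square above a parabola *)

Section Example.
Context {R : realType}.
Implicit Types (p z : 'rV[R]_2) (s t u v : R).

Local Notation px p := (p ord0 ord0).
Local Notation py p := (p ord0 ord_max).

Definition pt u v : 'rV[R]_2 := \row_j (if j == ord0 then u else v).

Lemma pt_x u v : px (pt u v) = u. Proof. by rewrite mxE. Qed.
Lemma pt_y u v : py (pt u v) = v. Proof. by rewrite mxE. Qed.

Lemma pt_eta p : p = pt (px p) (py p).
Proof.
by apply/rowP => -[[|[|//]] ?]; rewrite mxE; congr (p _ _); exact/val_inj.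
Qed.

Lemma pt_eq p u v : px p = u -> py p = v -> p = pt u v.
Proof. by move=> <- <-; exact: pt_eta. Qed.

Lemma enorm_pt u v : enorm (pt u v) = Num.sqrt (u ^+ 2 + v ^+ 2).
Proof.
by rewrite /enorm big_ord_recl big_ord1 !mxE.
Qed.

Lemma ptB u v u' v' : pt u v - pt u' v' = pt (u - u') (v - v').
Proof. by apply: pt_eq; rewrite !mxE. Qed.

Lemma seg_pt u v u' v' t :
  seg (pt u v) (pt u' v') t = pt ((1 - t) * u + t * u') ((1 - t) * v + t * v').
Proof. by apply: pt_eq; rewrite !mxE. Qed.

Definition Omega : set 'rV[R]_2 :=
  [set p | [/\ `|px p| < 8, `|py p| < 8 & 0 < 16 * py p + px p ^+ 2]].

Lemma above_parabola_continuous (T : topologicalType) (f g : T -> R) :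
  continuous f -> continuous g -> continuous (fun x => 16 * g x + f x ^+ 2).
Proof.
move=> cf cg x; apply: cvgD; first by apply: cvgMl_tmp; exact: cg.
by rewrite expr2; apply: cvgM; exact: cf.
Qed.

Lemma Omega_open : open Omega.
Proof.
have cx := @coord_continuous R 1 2 ord0 ord0.
have cy := @coord_continuous R 1 2 ord0 ord_max.
have -> : Omega = [set p | `|px p| < 8] `&` [set p | `|py p| < 8]
    `&` [set p | 0 < 16 * py p + px p ^+ 2].
  by apply/seteqP; split => p /=; [case|case=> -[]].
apply: openI; first apply: openI.
- apply: (@open_comp _ _ (fun p => `|px p|) [set r | r < 8]); last exact: open_lt.
  by move=> p _; exact: (cvg_norm (cx p)).
- apply: (@open_comp _ _ (fun p => `|py p|) [set r | r < 8]); last exact: open_lt.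
  by move=> p _; exact: (cvg_norm (cy p)).
- apply: (@open_comp _ _ (fun p => 16 * py p + px p ^+ 2) [set r | 0 < r]);
    last exact: open_gt.
  by move=> p _; exact: (above_parabola_continuous _ _ _ cx cy).
Qed.

Lemma Omega_bounded : bounded_set Omega.
Proof.
exists 8; split => // M M8 p [px8 py8 _] /=.
rewrite -[`|p|]/(mx_norm p) mx_normrE; apply: bigmax_le => [|[i j] _]/=.
  by apply: le_trans (ltW M8).
rewrite (ord1 i) (pt_eta p) mxE; case: ifP => _.
  exact: ltW (lt_trans px8 M8).
exact: ltW (lt_trans py8 M8).
Qed.

(** On or above the parabola y = - x^2 / 16, moving by a fraction s towards
    (0, 4) changes 16 y + x^2 into at least s (64 - (1 - s) x^2), positive as
    |x| < 8.  This is star-shapedness about (0, 4), including limits on the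
    parabola. *)
Lemma Omega_seg u v s : `|u| < 8 -> `|v| < 8 -> 0 <= 16 * v + u ^+ 2 ->
  0 < s -> s <= 1 -> Omega (seg (pt u v) (pt 0 4) s).
Proof.
rewrite !ltr_norml => /andP[u1 u2] /andP[v1 v2] uv s0 s1.
rewrite seg_pt /Omega/= pt_x pt_y !ltr_norml.
have u64 : u ^+ 2 < 64 by nra.
split; [nra|nra|].
have -> : 16 * ((1 - s) * v + s * 4) + ((1 - s) * u + s * 0) ^+ 2 =
  (1 - s) * (16 * v + u ^+ 2) + s * (64 - (1 - s) * u ^+ 2) by ring.
apply: ltr_wpDl; first by apply: mulr_ge0 => //; lra.
apply: mulr_gt0 => //.
have : 0 <= u ^+ 2 by exact: sqr_ge0.
nra.
Qed.

Lemma Omega_pt u v : `|u| < 8 -> `|v| < 8 -> 0 < 16 * v + u ^+ 2 ->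
  Omega (pt u v).
Proof. by move=> *; split; rewrite ?pt_x ?pt_y. Qed.

Lemma seg_continuous p z : continuous (seg p z).
Proof.
move=> t; apply: cvgD; apply: cvgZr_tmp; last exact: cvg_id.
by apply: cvgB; [exact: cvg_cst|exact: cvg_id].
Qed.

Lemma Omega_connected : connected Omega.
Proof.
have -> : Omega = \bigcup_(p in Omega) (seg p (pt 0 4) @` `[0, 1]).
  apply/seteqP; split => [p Op|q [p [px8 py8 pO] [s /= + <-]]].
    exists p => //; exists 0 => /=; first by rewrite in_itv/= lexx ler01.
    by rewrite /seg subr0 scale1r scale0r addr0.
  rewrite in_itv/= le_eqVlt => /andP[/predU1P[<- _|s0 s1]].
    by rewrite /seg subr0 scale1r scale0r addr0.
  by rewrite (pt_eta p); apply: Omega_seg => //; exact: ltW.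
apply: bigcup_connected.
  exists (pt 0 4) => p _; exists 1 => /=; first by rewrite in_itv/= lexx ler01.
  by rewrite /seg subrr scale0r add0r scale1r.
move=> p _; apply: connected_continuous_connected; first exact: segment_connected.
exact/continuous_subspaceT/seg_continuous.
Qed.

Lemma boundary_parabola u : `|u| < 8 -> boundary Omega (pt u (- u ^+ 2 / 16)).
Proof.
move=> u8.
have v8 : `|- u ^+ 2 / 16| < 8.
  by move: u8; rewrite !ltr_norml => /andP[u1 u2]; nra.
split; last first.
  rewrite (interior_id Omega).1; last exact: Omega_open.
  by case=> _ _; rewrite pt_x pt_y; lra.
move=> B nB.
have : \forall s \near (0 : R)^'+, B (seg (pt u (- u ^+ 2 / 16)) (pt 0 4) s).
  apply: (cvg_at_right_filter (seg_continuous _ _ 0)).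
  by rewrite /seg subr0 scale1r scale0r addr0.
move=> nearB; near (0 : R)^'+ => s.
exists (seg (pt u (- u ^+ 2 / 16)) (pt 0 4) s); split.
  apply: Omega_seg => //; first by lra.
  by near: s; exact: nbhs_right_le.
by near: s.
Unshelve. all: by end_near.
Qed.

Lemma boundary_origin : boundary Omega (pt 0 0).
Proof.
have := @boundary_parabola 0; rewrite normr0 expr0n/= oppr0 mul0r; apply; lra.
Qed.

Lemma Omega_dir : dir_boundary Omega (pt 6 0) (pt 0 0).
Proof.
split; first exact: boundary_origin.
move=> _ [t /= + <-]; rewrite in_itv/= => /andP[t0 t1].
rewrite seg_pt; apply: Omega_pt; rewrite ?ltr_norml; nra.
Qed.

(** With s = 1 - t, the point of the parabola below [seg t] = (6 s, 0) is at
    distance (6 s)^2 / 16 = 9 s^2 / 4, which is less than 6 alpha s as soon as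
    s < 8 alpha / 3. *)
Lemma Omega_not_str alpha : 0 < alpha -> alpha <= 1 ->
  ~ str_boundary Omega (pt 6 0) alpha (pt 0 0).
Proof.
move=> a0 a1 [_ /(_ (1 - alpha / 2))].
have -> : 0 < 1 - alpha / 2 < 1 by lra.
move=> /(_ isT); rewrite seg_pt ptB enorm_pt.
have -> : Num.min (1 - alpha / 2) (1 - (1 - alpha / 2)) = alpha / 2.
  by rewrite min_r; lra.
have -> : Num.sqrt ((6 - 0) ^+ 2 + (0 - 0) ^+ 2) = 6 :> R.
  by rewrite !subr0 expr0n addr0 sqrtr_sqr ger0_norm.
have u8 : `|3 * alpha| < 8 by rewrite ltr_norml; lra.
have := dist_le (pt (3 * alpha) 0) _ _ (boundary_parabola _ u8).
rewrite ptB enorm_pt subrr expr0n add0r sqrtr_sqr => d1.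
rewrite (_ : (1 - (1 - alpha / 2)) * 6 + _ = 3 * alpha); last by field.
rewrite (_ : _ * 0 + _ = 0); last by ring.
move=> /le_trans/(_ d1).
rewrite ger0_norm; nra.
Qed.

(** * The tent curve *)

Definition tent t : 'rV[R]_2 := pt (6 - 3 / 5 * t) (4 / 5 * Num.min t (10 - t)).

Lemma enorm345 (d : R) : 0 <= d -> Num.sqrt ((3 / 5 * d) ^+ 2 + (4 / 5 * d) ^+ 2) = d.
Proof.
move=> d0; rewrite (_ : _ + _ = d ^+ 2); last by field.
by rewrite sqrtr_sqr ger0_norm.
Qed.

Lemma tent_lipschitz1 : lipschitz1 tent.
Proof.
move=> s t st; rewrite ptB enorm_pt -[leRHS]enorm345 ?subr_ge0//.
apply: ler_wsqrtr; apply: lerD.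
  by rewrite (_ : _ ^+ 2 = (3 / 5 * (t - s)) ^+ 2)//; ring.
rewrite -mulrBr -ler_sqrt ?sqr_ge0// !sqrtr_sqr ler_norml.
rewrite ger0_norm; last by lra.
by case: (leP s (10 - s)); case: (leP t (10 - t)); lra.
Qed.

Lemma tent_arclength : arclength_curve tent 10.
Proof.
apply: (@arclength_curve_kinked _ _ _ 5) => //; first exact: tent_lipschitz1.
  move=> s t st t5; rewrite ptB enorm_pt !min_l; [|lra|lra].
  rewrite -[RHS]enorm345 ?subr_ge0//; congr (Num.sqrt (_ + _)); ring.
move=> s t s5 st; rewrite ptB enorm_pt !min_r; [|lra|lra].
rewrite -[RHS]enorm345 ?subr_ge0//; congr (Num.sqrt (_ + _)); ring.
Qed.

(** The point [tent t] has height 4 m / 5 for m = min(t, 10 - t) <= 5, and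
    abscissa between 0 and 6, so the ball of radius m / 4 about it stays in the
    open upper half of the square. *)
Lemma tent_ball t z : 0 < t < 10 ->
  enorm (tent t - z) < 4^-1 * Num.min t (10 - t) -> Omega z.
Proof.
move=> /andP[t0 t10] zt.
have := le_lt_trans (coord_le_enorm (tent t - z) ord0) zt.
have := le_lt_trans (coord_le_enorm (tent t - z) ord_max) zt.
rewrite (pt_eta z) ptB pt_x pt_y !ltr_norml => /andP[y1 y2] /andP[x1 x2].
have [m1 m2] : 0 < Num.min t (10 - t) /\ Num.min t (10 - t) <= 5.
  by case: (leP t (10 - t)) => ?; split; lra.
apply: Omega_pt; rewrite ?ltr_norml; first lra; first lra.
have := sqr_ge0 (px z); lra.
Qed.

Lemma Omega_visual : visual_boundary Omega (pt 6 0) 4 (pt 0 0).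
Proof.
split; first exact: boundary_origin.
have tent10 : tent 10 = pt 0 0.
  by rewrite /tent min_r; [congr pt; field|lra].
have tent0 : tent 0 = pt 6 0.
  by rewrite /tent min_l; [congr pt; field|lra].
exists 10, tent; split => //.
- by split => //; exact: tent_arclength.
- move=> _ [t /= + <-]; rewrite in_itv/= => /andP[].
  rewrite le_eqVlt => /predU1P[<- _|t0].
    by left; rewrite tent0; apply: Omega_pt; rewrite ?ltr_norml; lra.
  rewrite le_eqVlt => /predU1P[->|t10]; first by right.
  left; apply: (@tent_ball t); first by rewrite t0.
  rewrite subrr enorm0 mulr_gt0 ?invr_gt0// lt_min t0 subr_gt0//.
- rewrite ptB enorm_pt !subr0 expr0n addr0 sqrtr_sqr ger0_norm//; lra.
- move=> t t10; apply: bdist_ge; first exact: Omega_open.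
    by exists (pt 0 0); exact: boundary_origin.
  by move=> z; exact: tent_ball.
Qed.

End Example.

Theorem proposition5p1 (R : realType) :
  exists (Omega : set 'rV[R]_2) (x xi : 'rV[R]_2),
    [/\ domain Omega, bounded_set Omega, Omega x & boundary Omega xi] /\
    [/\ dir_boundary Omega x xi,
        forall alpha : R, 0 < alpha -> alpha <= 1 ->
          ~ str_boundary Omega x alpha xi &
        visual_boundary Omega x 4 xi].
Proof.
have Ox : Omega (pt 6 0 : 'rV[R]_2) by apply: Omega_pt; rewrite ?ltr_norml; lra.
exists Omega, (pt 6 0), (pt 0 0); split; split => //.
- split; [by exists (pt 6 0)|exact: Omega_open|exact: Omega_connected].
- exact: Omega_bounded.
- exact: boundary_origin.
- exact: Omega_dir.
- exact: Omega_not_str.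
- exact: Omega_visual.
Qed.
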